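(* For an integer $n\ge 0$ and a point $P\in S^n\subset\mathbb{R}^{n+1}$, let $\Phi_P:\mathbb{R}^{n+1}\to\mathbb{R}^{n+1}$ be the mapping $\Phi_P(x)=2(x\cdot P)x-P$. The following hold. (1) Let $P$ be a point of $S^1$. Then $\Phi_P|_{S^1}:S^1\to S^1$ is chaotic in the sense of Devaney. Moreover, it is chaotic in the sense of Kato. (2) Let $P$ be a point of $S^0$. Then $\Phi_P|_{D^1}:D^1\to D^1$ is chaotic in the sense of Devaney. Moreover, it is chaotic in the sense of Kato. (3) Let $m$ be an integer with $m\ge 2$. Then $\Phi_P|_{S^m}:S^m\to S^m$ is chaotic in the sense of Kato for every $P\in S^m$, and $\Phi_P|_{D^m}:D^m\to D^m$ is chaotic in the sense of Kato for every $P\in S^{m-1}$. (4) Let $m$ be an integer with $m\ge 2$. Then $\Phi_P|_{S^m}:S^m\to S^m$ is not transitive for any $P\in S^m$, and $\Phi_P|_{D^m}:D^m\to D^m$ is not transitive for any $P\in S^{m-1}$. In particular, none of these mappings is chaotic in the sense of Devaney.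
   Context: For an integer $n\ge 0$, $S^n$ and $D^{n+1}$ denote the unit sphere and the closed unit disk of $\mathbb{R}^{n+1}$ centered at the origin (so $S^0=\{-1,1\}$ and $D^1=[-1,1]$), with the metric induced from the Euclidean metric; $x\cdot P$ is the standard scalar product. For $P\in S^n$, the mapping $\Phi_P$ sends $S^n$ into $S^n$ and $D^{n+1}$ into $D^{n+1}$, so the restrictions are self-maps. Let $(X,d)$ be a metric space and $f:X\to X$ a continuous mapping; $f^k$ denotes the $k$-fold composition of $f$ with itself. - $f$ is sensitive if there is $\lambda>0$ such that for any $x\in X$ and any neighbourhood $U$ of $x$ in $X$ there exist a point $y\in U$ and an integer $k\ge 0$ with $d(f^k(x),f^k(y))>\lambda$. - $f$ is transitive if for any non-empty open subsets $U,V\subset X$ there exists an integer $k>0$ such that $f^k(U)\cap V\neq\emptyset$. - $f$ is accessible if for any $\lambda>0$ and any non-empty open subsets $U,V\subset X$ there exist points $u\in U$, $v\in V$ and an integer $k>0$ such that $d(f^k(u),f^k(v))\le\lambda$. - $f$ is chaotic in the sense of Devaney if $f$ is sensitive, transitive, and the set of periodic points of $f$ is dense in $X$. - $f$ is chaotic in the sense of Kato if $f$ is sensitive and accessible. *)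

(* Defs.v *)
From HB Require Import structures.
From mathcomp Require Import all_boot all_order all_algebra.
From mathcomp Require Import all_classical all_reals all_analysis.
From mathcomp Require Import ring lra.

Set Implicit Arguments.
Unset Strict Implicit.
Unset Printing Implicit Defensive.
Import Order.TTheory GRing.Theory Num.Theory.
Import numFieldNormedType.Exports.

Local Open Scope classical_set_scope.
Local Open Scope ring_scope.

Section chaos.
Context {R : realType} {X : metricType R}.
Implicit Type f : continuousType X X.

Definition sensitive f : Prop :=
  exists2 lambda : R, 0 < lambda &
    forall (x : X) (U : set X), nbhs x U ->
      exists y k, U y /\ lambda < mdist (iter k f x) (iter k f y).

Definition topologically_transitive f : Prop :=
  forall U V : set X, open U -> U !=set0 -> open V -> V !=set0 ->
    exists2 k, (0 < k)%N & (iter k f @` U) `&` V !=set0.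

Definition accessible f : Prop :=
  forall lambda : R, 0 < lambda ->
  forall U V : set X, open U -> U !=set0 -> open V -> V !=set0 ->
    exists u v k,
      [/\ U u, V v, (0 < k)%N & mdist (iter k f u) (iter k f v) <= lambda].

Definition periodic_points f : set X :=
  [set x | exists2 k, (0 < k)%N & iter k f x = x].

Definition devaney_chaotic f : Prop :=
  [/\ sensitive f, topologically_transitive f & dense (periodic_points f)].

Definition kato_chaotic f : Prop := sensitive f /\ accessible f.

End chaos.

(* The subset topology on [set_type A] is already in the library; this adds
   the induced distance. *)
Section set_type_metric.
Context {R : realType} {X : metricType R} (A : set X).

Let dist (x y : A) : R := mdist (set_val x) (set_val y).

Let dist_ge0 x y : 0 <= dist x y. Proof. exact: mdist_ge0. Qed.

Let dist_positivity x y : dist x y = 0 -> x = y.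
Proof. by move=> /mdist_positivity /val_inj. Qed.

Let ballEdist x d : ball x d = [set y | dist x y < d].
Proof. by rewrite -[ball x d]/(set_val @^-1` ball (set_val x) d) ballEmdist. Qed.

HB.instance Definition _ := @PseudoMetric_isMetric.Build R (A : Type)
  dist dist_ge0 dist_positivity ballEdist.

Lemma mdist_set_val (x y : A) : mdist x y = mdist (set_val x) (set_val y).
Proof. by []. Qed.

End set_type_metric.

(* An alias of ['rV[R]_n], because the metric structure that the library
   gives to ['rV[R]_n] itself is that of the sup norm. *)
Definition euclid (R : realType) (n : nat) : Type := 'rV[R]_n.

HB.instance Definition _ (R : realType) n := GRing.Lmodule.on (euclid R n).

Section euclid.
Context {R : realType} {n : nat}.
Implicit Types (x y z : euclid R n) (a : R).

Definition dot x y : R := \sum_(i < n) x 0 i * y 0 i.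

Definition enorm x : R := Num.sqrt (dot x x).

Lemma dotC x y : dot x y = dot y x.
Proof. by apply: eq_bigr => i _; rewrite mulrC. Qed.

Lemma dotDl x y z : dot (x + y) z = dot x z + dot y z.
Proof. by rewrite -big_split; apply: eq_bigr => i _; rewrite mxE mulrDl. Qed.

Lemma dotZl a x y : dot (a *: x) y = a * dot x y.
Proof. by rewrite mulr_sumr; apply: eq_bigr => i _; rewrite mxE mulrA. Qed.

Lemma dotDr x y z : dot x (y + z) = dot x y + dot x z.
Proof. by rewrite dotC dotDl !(dotC x). Qed.

Lemma dotZr a x y : dot x (a *: y) = a * dot x y.
Proof. by rewrite dotC dotZl dotC. Qed.

Lemma dotNl x y : dot (- x) y = - dot x y.
Proof. by rewrite -scaleN1r dotZl mulN1r. Qed.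

Lemma dotNr x y : dot x (- y) = - dot x y.
Proof. by rewrite dotC dotNl dotC. Qed.

Definition dotE := (dotDl, dotDr, dotZl, dotZr, dotNl, dotNr).

Lemma dot_ge0 x : 0 <= dot x x.
Proof. by apply: sumr_ge0 => i _; rewrite -expr2 sqr_ge0. Qed.

Lemma dot_eq0 x : dot x x = 0 -> x = 0.
Proof.
have p i : true -> 0 <= x 0 i * x 0 i by rewrite -expr2 sqr_ge0.
move=> /(psumr_eq0P p) x0; apply/rowP => i; rewrite [RHS]mxE.
by have /eqP := x0 i isT; rewrite mulf_eq0 orbb => /eqP.
Qed.

Lemma enorm_ge0 x : 0 <= enorm x. Proof. exact: sqrtr_ge0. Qed.

Lemma enorm_sqr x : enorm x ^+ 2 = dot x x.
Proof. by rewrite sqr_sqrtr // dot_ge0. Qed.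

Lemma dot_sqr_le x y : dot x y ^+ 2 <= dot x x * dot y y.
Proof.
have [y0|yN0] := eqVneq (dot y y) 0.
  have -> : dot x y = 0.
    by rewrite (dot_eq0 y0) -(scale0r (0 : euclid R n)) dotZr mul0r.
  by rewrite y0 mulr0 expr0n.
have y_gt0 : 0 < dot y y by rewrite lt_def yN0 dot_ge0.
rewrite -subr_ge0 -(pmulr_rge0 _ y_gt0).
suff <- : dot (dot y y *: x - dot x y *: y) (dot y y *: x - dot x y *: y) =
    dot y y * (dot x x * dot y y - dot x y ^+ 2) by exact: dot_ge0.
by rewrite !dotE (dotC y x); ring.
Qed.

Lemma dot_le x y : `|dot x y| <= enorm x * enorm y.
Proof.
by rewrite -sqrtr_sqr -sqrtrM ?dot_ge0 // ler_wsqrtr // dot_sqr_le.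
Qed.

Lemma enormD x y : enorm (x + y) <= enorm x + enorm y.
Proof.
rewrite -(@ler_pXn2r _ 2) ?nnegrE ?addr_ge0 ?enorm_ge0 //.
rewrite sqrrD !enorm_sqr !dotE (dotC y x).
have := le_trans (ler_norm _) (dot_le x y); lra.
Qed.

Lemma enormZ a x : enorm (a *: x) = `|a| * enorm x.
Proof.
by rewrite /enorm dotZl dotZr mulrA -expr2 sqrtrM ?sqr_ge0 // sqrtr_sqr.
Qed.

Lemma enormN x : enorm (- x) = enorm x.
Proof. by rewrite -scaleN1r enormZ normrN1 mul1r. Qed.

Let dist x y : R := enorm (x - y).

Let distxx x : dist x x = 0.
Proof. by rewrite /dist subrr -(scale0r (0 : euclid R n)) enormZ normr0 mul0r. Qed.

Let dist_positivity x y : dist x y = 0 -> x = y.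
Proof.
move=> d0; apply/eqP; rewrite -subr_eq0; apply/eqP/dot_eq0.
by rewrite -enorm_sqr -/(dist x y) d0 expr0n.
Qed.

Let dist_sym x y : dist x y = dist y x.
Proof. by rewrite /dist -enormN opprB. Qed.

Let dist_triangle y x z : dist x z <= dist x y + dist y z.
Proof. by rewrite /dist -[x - z](subrKA y) enormD. Qed.

HB.instance Definition _ := @isMetric.Build R (euclid R n)
  dist distxx dist_positivity dist_sym dist_triangle.

Lemma mdist_euclid x y : mdist x y = enorm (x - y). Proof. by []. Qed.

End euclid.

(* Both are indexed by the dimension of the ambient space: S^n is
   [usphere R n.+1], while D^n is [udisk R n]; thus S^m.-1 and D^m are
   [usphere R m] and [udisk R m], with no cast. *)
Definition usphere (R : realType) (n : nat) : set (euclid R n) :=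
  [set x | enorm x = 1].

Definition udisk (R : realType) (n : nat) : set (euclid R n) :=
  [set x | enorm x <= 1].

Arguments usphere : clear implicits.
Arguments udisk : clear implicits.

Definition Phi (R : realType) (n : nat) (P x : euclid R n) : euclid R n :=
  (2 * dot x P) *: x - P.

Section restrictions.
Context {R : realType} {n : nat}.
Implicit Type P : usphere R n.

Lemma dot_Phi (P x : euclid R n) : enorm P = 1 ->
  dot (Phi P x) (Phi P x) = 1 - 4 * dot x P ^+ 2 * (1 - dot x x).
Proof.
move=> P1; rewrite /Phi !dotE (dotC P x) -(enorm_sqr P) P1; ring.
Qed.

Lemma Phi_usphere P : {homo Phi (set_val P) : x / usphere R n x}.
Proof.
move=> x x1; rewrite /usphere /= /enorm dot_Phi; last exact: (set_valP P).
by rewrite -(enorm_sqr x) x1 expr1n subrr mulr0 subr0 sqrtr1.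
Qed.

Lemma Phi_udisk P : {homo Phi (set_val P) : x / udisk R n x}.
Proof.
move=> x x1; rewrite /udisk /= /enorm dot_Phi; last exact: (set_valP P).
rewrite -[leRHS]sqrtr1 ler_wsqrtr // gerBl mulr_ge0 //.
  by rewrite mulr_ge0 // sqr_ge0.
by rewrite -enorm_sqr subr_ge0 expr_le1 // enorm_ge0.
Qed.

Lemma Phi_lipschitz P (x y : euclid R n) : udisk R n x -> udisk R n y ->
  mdist (Phi (set_val P) x) (Phi (set_val P) y) <= 4 * mdist x y.
Proof.
rewrite !mdist_euclid => x1 y1; set p := set_val P.
have p1 : enorm p = 1 by exact: (set_valP P).
have -> : Phi p x - Phi p y =
    (2 * dot x p) *: (x - y) + (2 * dot (x - y) p) *: y.
  by apply/rowP => i; rewrite /Phi !dotE !mxE; ring.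
rewrite (le_trans (enormD _ _)) // !enormZ !normrM ger0_norm //.
have := dot_le x p; have := dot_le (x - y) p; rewrite p1 !mulr1 => d1 d2.
have e0 := enorm_ge0 (x - y).
have h1 : `|dot x p| * enorm (x - y) <= enorm (x - y).
  by rewrite ler_piMl // (le_trans d2).
have h2 : `|dot (x - y) p| * enorm y <= enorm (x - y).
  by rewrite (le_trans _ d1) // ler_piMr.
lra.
Qed.

Definition Phi_sphere P (x : usphere R n) : usphere R n :=
  SigSub (mem_set (Phi_usphere P (set_valP x))).

Definition Phi_disk P (x : udisk R n) : udisk R n :=
  SigSub (mem_set (Phi_udisk P (set_valP x))).

Lemma lipschitz_continuous_mdist (X : metricType R) (f : X -> X) (k : R) :
  0 < k -> (forall x y, mdist (f x) (f y) <= k * mdist x y) -> continuous f.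
Proof.
move=> k0 fk x; apply/metricType_numDomainType.cvgrPdist_lt => e e0.
have := @metricType_numDomainType.cvgr_dist_lt _ _ _ (nbhs x) _ id x
  (@cvg_id _ _) (e / k) (divr_gt0 e0 k0).
move=> /(_ _); apply: filterS => y; rewrite ltr_pdivlMr // mulrC.
exact: le_lt_trans.
Qed.

Lemma Phi_sphere_continuous P : continuous (Phi_sphere P).
Proof.
apply: (@lipschitz_continuous_mdist _ _ 4) => // x y.
rewrite !mdist_set_val; apply: Phi_lipschitz; rewrite /udisk /=.
  by rewrite (set_valP x).
by rewrite (set_valP y).
Qed.

Lemma Phi_disk_continuous P : continuous (Phi_disk P).
Proof.
apply: (@lipschitz_continuous_mdist _ _ 4) => // x y.
by rewrite !mdist_set_val; apply: Phi_lipschitz; exact: set_valP.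
Qed.

HB.instance Definition _ P :=
  isContinuous.Build _ _ (Phi_sphere P) (@Phi_sphere_continuous P).

HB.instance Definition _ P :=
  isContinuous.Build _ _ (Phi_disk P) (@Phi_disk_continuous P).

End restrictions.

(* Main.v *)
(* For a unit vector [P] and any [w] orthogonal to [P], [Phi P] maps
   [cos t P + sin t w] to [cos (2t) P + sin (2t) w], so it doubles the angle on
   a family of arcs that cover the sphere or the disk and all pass through the
   fixed point [P] (at [t = 0]) and through [-P] (at [t = pi]).  Inside a small
   interval of angles, [2^k t] takes every value mod [2 pi] once [k] is large:
   every open set contains points sent to [P] and points sent to [-P] at the
   same time [k], which gives sensitivity and accessibility.  On S^1 and D^1 a
   single arc covers everything, and the same remark gives transitivity and
   dense periodic points.  In higher dimension [w] is, up to sign, a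
   nonconstant invariant, which excludes transitivity. *)
Require Import Defs.
From mathcomp Require Import all_boot all_order all_algebra.
From mathcomp Require Import all_classical all_reals all_analysis.
From mathcomp Require Import ring lra.

(** * Curves on which the map doubles the parameter *)

Section DoublingCurve.
Set Implicit Arguments.
Unset Strict Implicit.
Import Order.TTheory GRing.Theory Num.Theory.
Import numFieldNormedType.Exports.
Local Open Scope classical_set_scope.
Local Open Scope ring_scope.
Context {R : realType} {X : metricType R} {f : continuousType X X}.
Implicit Types (c : R -> X) (t s : R) (p q : X).

(** A semiconjugacy from angle doubling on R / 2 pi Z, lifted to R. The curve may retrace itself, as
    [cos t P] does. *)
Definition doubling_curve (g : X -> X) c : Prop :=
  [/\ continuous c, forall t, c (t + pi *+ 2) = c t
    & forall t, g (c t) = c (2 * t)].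

Lemma iter_doubling_curve c k t :
  doubling_curve f c -> iter k f (c t) = c (2 ^+ k * t).
Proof.
case=> _ _ fc; elim: k => [|k IHk]; first by rewrite expr0 mul1r.
by rewrite iterS IHk fc mulrA exprS.
Qed.

Lemma doubling_curveDint c t (j : int) :
  doubling_curve f c -> c (t + j%:~R * (pi *+ 2)) = c t.
Proof.
case=> _ cD _; have cDn s n : c (s + n%:R * (pi *+ 2)) = c s.
  elim: n => [|n IHn]; first by rewrite mul0r addr0.
  by rewrite -natr1 mulrDl mul1r addrA cD.
case: j => n; first exact: cDn.
by rewrite NegzE -(cDn _ n.+1) -addrA mulrNz mulNr addNr addr0.
Qed.

(** The parameters [(s + 2 pi j) / a] are spaced by 2 pi / a, so for large [a] one of them is close
    to [t]. The scale [a] is general because hitting times use 2^k and periodic points use 2^k -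
    1. *)
Lemma doubling_curve_near c t (U : set X) :
  doubling_curve f c -> nbhs (c t) U ->
  exists A : R, forall a s, A < a ->
    exists j : int, U (c ((s + j%:~R * (pi *+ 2)) / a)).
Proof.
case=> cc _ _ /(cc t) /nbhs_ballP [e /= e0 eU].
have pi2 : 0 < pi *+ 2 :> R by rewrite mulrn_wgt0 // pi_gt0.
exists (pi *+ 2 / e) => a s aA.
have a0 : 0 < a by rewrite (lt_trans _ aA) // divr_gt0.
(* This [j] gives the last such parameter that does not exceed [t]. *)
exists (Num.floor ((a * t - s) / (pi *+ 2))); apply: eU.
rewrite -ball_normE /=; set j := Num.floor _.
have /andP[] := floor_itv ((a * t - s) / (pi *+ 2)); rewrite -/j.
rewrite intrD ler_pdivlMr // ltr_pdivrMr // mulrDl mul1r => j1 j2.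
rewrite ger0_norm.
  rewrite ltrBlDr -ltrBlDl ltr_pdivlMr // mulrBl.
  by move: aA; rewrite ltr_pdivrMr //; lra.
by rewrite subr_ge0 ler_pdivrMr //; lra.
Qed.

Lemma doubling_curve_hit c t s (U : set X) :
  doubling_curve f c -> nbhs (c t) U ->
  exists K, forall k, (K <= k)%N -> exists2 y, U y & iter k f y = c s.
Proof.
move=> dc tU; have [A AU] := doubling_curve_near dc tU.
exists (Num.bound A) => k /upper_nthrootP Ak.
have [j Uj] := AU _ s Ak; exists (c ((s + j%:~R * (pi *+ 2)) / 2 ^+ k)) => //.
rewrite iter_doubling_curve // mulrC divfK ?expf_neq0 ?pnatr_eq0 //.
exact: doubling_curveDint.
Qed.

(** Multiplying [2 pi j / (2^k - 1)] by 2^k adds exactly 2 pi j to it, so the corresponding point of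
    the curve has period k. *)
Lemma doubling_curve_periodic c t (U : set X) :
  doubling_curve f c -> nbhs (c t) U -> U `&` periodic_points f !=set0.
Proof.
move=> dc tU; have [A AU] := doubling_curve_near dc tU.
(* One bound gives both 2^(K+1) - 1 > A and 2^(K+1) - 1 > 0, the latter to divide by it. *)
set K := Num.bound (Num.max A 0 + 1).
have := upper_nthrootP (leqnSn K); rewrite -ltrBrDr gt_max => /andP[Ak k0].
have [j Uj] := AU _ 0 Ak; exists (c ((0 + j%:~R * (pi *+ 2)) / (2 ^+ K.+1 - 1))).
split=> //; exists K.+1 => //.
rewrite iter_doubling_curve // -[RHS](doubling_curveDint _ j) //; congr c.
by field; rewrite gt_eqF.
Qed.

Lemma doubling_curve_devaney c :
  doubling_curve f c -> (forall x, exists t, x = c t) ->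
  topologically_transitive f /\ dense (periodic_points f).
Proof.
move=> dc csurj; split.
  move=> U V oU [u Uu] oV [v Vv].
  have [t uE] := csurj u; have [s vE] := csurj v.
  have Ut : nbhs (c t) U by rewrite -uE; apply: open_nbhs_nbhs.
  have [K KU] := doubling_curve_hit s dc Ut.
  (* The successor makes the time positive even if [K] is 0. *)
  have [y Uy yE] := KU K.+1 (leqnSn K).
  by exists K.+1 => //; exists v; split=> //; exists y => //; rewrite yE.
move=> U [u Uu] oU; have [t uE] := csurj u.
apply: (doubling_curve_periodic (t := t) dc); rewrite -uE.
exact: open_nbhs_nbhs.
Qed.

(* From any open set, [p] and [q] are both hit at every late enough time. *)
Lemma doubling_curves_kato p q : p != q ->
  (forall x, exists c t,
     [/\ doubling_curve f c, c 0 = p, c pi = q & x = c t]) ->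
  kato_chaotic f.
Proof.
move=> pq cover.
have hit (x : X) (U : set X) : nbhs x U -> exists K, forall k, (K <= k)%N ->
    (exists2 y, U y & iter k f y = p) /\ (exists2 y, U y & iter k f y = q).
  have [c [t [dc c0 cpi ->]]] := cover x => tU.
  have [K1 H1] := doubling_curve_hit 0 dc tU.
  have [K2 H2] := doubling_curve_hit pi dc tU.
  exists (maxn K1 K2) => k; rewrite geq_max => /andP[k1 k2].
  by rewrite -c0 -cpi; split; [exact: H1|exact: H2].
have d0 : 0 < mdist p q by rewrite mdist_gt0.
split.
  (* No point lies within a third of the distance from both [p] and [q], so one of the two hits is
     far from the orbit of [x]. *)
  exists (mdist p q / 3) => [|x U xU]; first by rewrite divr_gt0.
  have [K /(_ K (leqnn K))[[y Uy yE] [z Uz zE]]] := hit x U xU.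
  case: (ltP (mdist p q / 3) (mdist (iter K f x) p)) => xp.
    by exists y, K; rewrite yE.
  exists z, K; rewrite zE; split=> //.
  have := metric_triangle p (iter K f x) q.
  rewrite (metric_sym p (iter K f x)); lra.
move=> e e0 U V oU [u Uu] oV [v Vv].
have [K1 H1] := hit u U (open_nbhs_nbhs (conj oU Uu)).
have [K2 H2] := hit v V (open_nbhs_nbhs (conj oV Vv)).
(* Both open sets reach [p] at one common positive time. *)
have [|[y Uy yE] _] := H1 (maxn K1 K2).+1.
  by rewrite (leq_trans (leq_maxl K1 K2)).
have [|[z Vz zE] _] := H2 (maxn K1 K2).+1.
  by rewrite (leq_trans (leq_maxr K1 K2)).
exists y, z, (maxn K1 K2).+1; split=> //.
by rewrite yE zE mdistxx ltW.
Qed.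

Lemma lipschitz_continuous_real (g : X -> R) (k : R) : 0 < k ->
  (forall x y, `|g x - g y| <= k * mdist x y) -> continuous g.
Proof.
move=> k0 gk x; apply/cvgrPdist_lt => e e0.
have := @metricType_numDomainType.cvgr_dist_lt _ _ _ (nbhs x) _ id x
  (@cvg_id _ _) (e / k) (divr_gt0 e0 k0).
move=> /(_ _); apply: filterS => y; rewrite ltr_pdivlMr // mulrC.
exact: le_lt_trans.
Qed.

Lemma continuous_quadratic (a b : X -> R) : continuous a -> continuous b ->
  continuous (fun x => a x ^+ 2 - (1 - b x ^+ 2) / 2).
Proof.
move=> ca cb x; under eq_fun do rewrite !expr2.
apply: cvgB; first exact: cvgM (ca x) (ca x).
apply: cvgM; last exact: cvg_cst.
by apply: cvgB; [exact: cvg_cst|exact: cvgM (cb x) (cb x)].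
Qed.

(** An orbit starting where g > 0 stays where g >= 0, hence never enters the open set g < 0. Only
    the sign is tracked, because [Phi] multiplies the chosen [g] by a nonnegative factor. *)
Lemma invariant_not_transitive (g : X -> R) : continuous g ->
  (forall x, 0 <= g x -> 0 <= g (f x)) ->
  (exists x, 0 < g x) -> (exists x, g x < 0) ->
  ~ topologically_transitive f.
Proof.
move=> cg inv [u gu] [v gv] tr.
have [] := tr (g @^-1` [set x | 0 < x]) (g @^-1` [set x | x < 0]).
- by apply: open_comp => [x _|]; [exact: cg|exact: open_gt].
- by exists u.
- by apply: open_comp => [x _|]; [exact: cg|exact: open_lt].
- by exists v.
move=> k _ [_ [[y /= gy <-]]]; apply/negP; rewrite -leNgt.
by elim: k => [|k IHk]; [exact: ltW|exact: inv].
Qed.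

End DoublingCurve.

(** * Arcs through the poles [P] and [- P] *)

Section Arc.
Set Implicit Arguments.
Unset Strict Implicit.
Import Order.TTheory GRing.Theory Num.Theory.
Import numFieldNormedType.Exports.
Local Open Scope classical_set_scope.
Local Open Scope ring_scope.
Context {R : realType}.

Lemma cos_sin_surj (a b : R) : a ^+ 2 + b ^+ 2 = 1 ->
  exists t, cos t = a /\ sin t = b.
Proof.
move=> ab; have a1 : -1 <= a <= 1.
  by have b2 := sqr_ge0 b; apply/andP; split; nra.
have bE : Num.sqrt (1 - a ^+ 2) = `|b| by rewrite -sqrtr_sqr; congr Num.sqrt; lra.
have [b0|b0] := leP 0 b.
  by exists (acos a); rewrite acosK ?in_itv //= sin_acos // bE ger0_norm.
exists (- acos a); rewrite cosN sinN acosK ?in_itv //= sin_acos // bE.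
by rewrite ltr0_norm // opprK.
Qed.

(** With the vectors of [s] as columns, a matrix with n rows has rank less than n; a nonzero vector
    of its left kernel is then normalized. *)
Lemma exists_unit_orthogonal n (s : seq (euclid R n)) : (size s < n)%N ->
  exists2 w : euclid R n, enorm w = 1 & forall v, v \in s -> dot w v = 0.
Proof.
move=> sn; pose M := \matrix_(i < n, j < size s) (s`_j) 0 i.
have K0 : nz_row (kermx M) != 0.
  rewrite nz_row_eq0 -mxrank_eq0 mxrank_ker subn_eq0 -ltnNge.
  exact: leq_ltn_trans (rank_leq_col M) sn.
have uM : nz_row (kermx M) *m M = 0 by apply/sub_kermxP/nz_row_sub.
move: (nz_row _) K0 uM => u u0 uM.
have e0 : enorm (u : euclid R n) != 0.
  apply: contraNneq u0 => e0; apply/eqP/(@dot_eq0 R n).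
  by rewrite -enorm_sqr e0 expr0n.
exists ((enorm (u : euclid R n))^-1 *: (u : euclid R n)).
  by rewrite enormZ ger0_norm ?invr_ge0 ?enorm_ge0 // mulVf.
move=> v vs; rewrite dotZl; have vi : (index v s < size s)%N by rewrite index_mem.
have := congr1 (fun B : 'M[R]_(1, size s) => B 0 (Ordinal vi)) uM.
rewrite !mxE => uv; rewrite [dot _ _](_ : _ = 0) ?mulr0 // -[RHS]uv.
by apply: eq_bigr => i _; rewrite !mxE /= nth_index.
Qed.

Section Pole.
Context {n : nat} {P : euclid R n}.
Hypothesis P1 : enorm P = 1.
Implicit Types w x : euclid R n.

(** For [w] orthogonal to [P]: a great circle if [w] is a unit vector, an ellipse in the disk if it
    is shorter, a segment if it is 0. *)
Definition arc w (t : R) : euclid R n := cos t *: P + sin t *: w.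

Let PP : dot P P = 1. Proof. by rewrite -enorm_sqr P1 expr1n. Qed.

Lemma arc0 w : arc w 0 = P.
Proof. by rewrite /arc cos0 sin0 scale1r scale0r addr0. Qed.

Lemma arcpi w : arc w pi = - P.
Proof. by rewrite /arc cospi sinpi scaleN1r scale0r addr0. Qed.

Lemma dot_arc w t : dot w P = 0 ->
  dot (arc w t) (arc w t) = 1 - sin t ^+ 2 * (1 - dot w w).
Proof.
move=> wP; rewrite /arc !dotE (dotC P w) wP PP.
have := cos2Dsin2 t; nra.
Qed.

Lemma usphere_arc w t : dot w P = 0 -> enorm w = 1 -> usphere R n (arc w t).
Proof.
move=> wP w1; rewrite /usphere /= /enorm dot_arc // -(enorm_sqr w) w1.
by rewrite expr1n subrr mulr0 subr0 sqrtr1.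
Qed.

Lemma udisk_arc w t : dot w P = 0 -> enorm w <= 1 -> udisk R n (arc w t).
Proof.
move=> wP w1; rewrite /udisk /= /enorm dot_arc // -(enorm_sqr w).
rewrite -[leRHS]sqrtr1 ler_wsqrtr // gerBl mulr_ge0 ?sqr_ge0 //.
by rewrite subr_ge0 expr_le1 // enorm_ge0.
Qed.

Lemma Phi_arc w t : dot w P = 0 -> Phi P (arc w t) = arc w (2 * t).
Proof.
move=> wP; rewrite /Phi {1}/arc !dotE wP PP mulr0 addr0 mulr1.
rewrite (mulr_natl t 2) /arc cos_mulr2n sin_mulr2n.
by apply/rowP => i; rewrite !mxE; ring.
Qed.

(** The angle is acos (x . P), and [w] is the rescaled component of [x] orthogonal to [P]. At the
    poles this component vanishes and any [w] fits; the caller supplies a [w0] whose arc stays in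
    the set at hand. *)
Lemma exists_arc w0 x : dot w0 P = 0 -> udisk R n x ->
  exists w t, [/\ dot w P = 0, x = arc w t & sin t != 0 \/ w = w0].
Proof.
move=> w0P x1; set a := dot x P.
have xx1 : dot x x <= 1 by rewrite -enorm_sqr expr_le1 // enorm_ge0.
have a1 : -1 <= a <= 1.
  by rewrite -ler_norml (le_trans (dot_le _ _)) // P1 mulr1.
have ca : cos (acos a) = a by rewrite acosK ?in_itv.
have [s0|s0] := eqVneq (sin (acos a)) 0.
  exists w0, (acos a); split=> //; last by right.
  (* The squared norm of x - a P is x . x - a^2 <= 1 - a^2 = sin^2 (acos a) = 0. *)
  rewrite /arc s0 scale0r addr0 ca; apply/eqP; rewrite -subr_eq0; apply/eqP.
  apply: dot_eq0; apply/eqP; rewrite eq_le dot_ge0 andbT.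
  have := sin2cos2 (acos a); rewrite s0 ca !dotE (dotC P x) PP -/a; nra.
exists ((sin (acos a))^-1 *: (x - a *: P)), (acos a); split; last by left.
  by rewrite !dotE PP -/a mulr1 subrr mulr0.
by rewrite /arc scalerA mulfV // scale1r ca addrC subrK.
Qed.

Section Restriction.
Context {A : set (euclid R n)} {f : continuousType A A}.
Hypothesis fE : forall x : A, set_val (f x) = Phi P (set_val x).

Lemma arc_doubling_curve w : dot w P = 0 -> (forall t, A (arc w t)) ->
  exists2 c : R -> A, doubling_curve f c & forall t, set_val (c t) = arc w t.
Proof.
move=> wP Aw; pose c t : A := SigSub (mem_set (Aw t)).
have cE t : set_val (c t) = arc w t by [].
exists c => //; split=> [t|t|t].
- apply/metricType_numDomainType.cvgrPdist_lt => e e0.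
  (* The distance is at most |cos t - cos s| + |sin t - sin s| |w|, so a tolerance of e / (1 + |w|)
     on each difference is enough. *)
  have w0 : 0 < 1 + enorm w by rewrite ltr_pwDl ?enorm_ge0.
  have d0 : 0 < e / (1 + enorm w) by rewrite divr_gt0.
  have /cvgrPdist_lt/(_ _ d0) := @continuous_cos R t.
  have /cvgrPdist_lt/(_ _ d0) := @continuous_sin R t.
  apply: filterS2 => s ss cs; rewrite mdist_set_val !cE mdist_euclid.
  have -> : arc w t - arc w s = (cos t - cos s) *: P + (sin t - sin s) *: w.
    by apply/rowP => i; rewrite !mxE; ring.
  rewrite (le_lt_trans (enormD _ _)) // !enormZ P1 mulr1.
  rewrite -[ltRHS](divfK (lt0r_neq0 w0)) mulrDr mulr1.
  by rewrite ltr_leD // ler_wpM2r ?enorm_ge0 // ltW.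
- by apply: val_inj; rewrite /= /arc cosD2pi sinD2pi.
- by apply: val_inj; rewrite [LHS]fE cE Phi_arc.
Qed.

Lemma arc_kato : A P -> A (- P) ->
  (forall x, A x -> exists w t,
     [/\ dot w P = 0, forall s, A (arc w s) & x = arc w t]) ->
  kato_chaotic f.
Proof.
move=> AP AN cover.
pose p : A := SigSub (mem_set AP); pose q : A := SigSub (mem_set AN).
apply: (@doubling_curves_kato _ _ f p q).
  apply/eqP => /(congr1 set_val) /= /(congr1 (dot P)).
  by rewrite dotNr PP; lra.
move=> x; have [w [t [wP Aw xE]]] := cover _ (set_valP x).
have [c dc cE] := arc_doubling_curve wP Aw.
exists c, t; split=> //; apply: val_inj; last by rewrite [RHS]cE.
  by rewrite [LHS]cE arc0.
by rewrite [LHS]cE arcpi.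
Qed.

Lemma arc_devaney w : dot w P = 0 -> (forall t, A (arc w t)) ->
  (forall x, A x -> exists t, x = arc w t) ->
  topologically_transitive f /\ dense (periodic_points f).
Proof.
move=> wP Aw cover; have [c dc cE] := arc_doubling_curve wP Aw.
apply: (doubling_curve_devaney dc) => x.
have [t xE] := cover _ (set_valP x).
by exists t; apply: val_inj; rewrite [RHS]cE -xE.
Qed.

(* Writing [x = cos t P + sin t w] with [w] orthogonal to [P], the sign of
   [g x] tells whether [(w . e)^2] is more or less than 1/2, and [w] is
   preserved by [Phi P]. *)
Lemma Phi_restriction_not_transitive (e : euclid R n) (u v : A) :
  let g (x : A) := dot (set_val x) e ^+ 2 - (1 - dot (set_val x) P ^+ 2) / 2 in
  dot e P = 0 -> 0 < g u -> g v < 0 ->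
  ~ topologically_transitive f.
Proof.
move=> g eP gu gv.
have cdot (y : euclid R n) : continuous (fun x : A => dot (set_val x) y : R).
  apply: (@lipschitz_continuous_real _ _ _ (1 + enorm y)).
    by rewrite ltr_pwDl ?enorm_ge0.
  move=> x z; rewrite mdist_set_val mdist_euclid -dotNl -dotDl.
  rewrite (le_trans (dot_le _ _)) // mulrC ler_wpM2r ?enorm_ge0 //.
  by rewrite lerDr.
apply: (@invariant_not_transitive _ _ _ g).
- exact: continuous_quadratic.
(* With a = x . P and b = x . e, the image has products 2 a^2 - 1 with [P] and 2 a b with [e], and 1
   - (2 a^2 - 1)^2 = 4 a^2 (1 - a^2). *)
- move=> x gx; rewrite (_ : g (f x) = 4 * dot (set_val x) P ^+ 2 * g x).
    by rewrite mulr_ge0 // mulr_ge0 // sqr_ge0.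
  by rewrite /g fE /Phi !dotE PP (dotC P e) eP; field.
- by exists u.
- by exists v.
Qed.

End Restriction.
End Pole.
End Arc.

(** * Application to spheres and disks *)

Section SphereDisk.
Set Implicit Arguments.
Unset Strict Implicit.
Import Order.TTheory GRing.Theory Num.Theory.
Import numFieldNormedType.Exports.
Local Open Scope classical_set_scope.
Local Open Scope ring_scope.
Context {R : realType}.

Lemma usphere_udisk n (x : euclid R n) : usphere R n x -> udisk R n x.
Proof. by rewrite /usphere /udisk /= => ->. Qed.

Lemma usphereN n (x : euclid R n) : usphere R n x -> usphere R n (- x).
Proof. by rewrite /usphere /= enormN. Qed.

Lemma dot0v n (x : euclid R n) : dot 0 x = 0.
Proof. by rewrite -(scale0r (0 : euclid R n)) dotZl mul0r. Qed.

Lemma enorm0 n : enorm (0 : euclid R n) = 0.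
Proof. by rewrite /enorm dot0v sqrtr0. Qed.

(** Away from the poles, |x| = 1 forces |w| = 1. At the poles the fallback is a unit vector
    orthogonal to [P], which exists since 2 <= n. *)
Lemma kato_Phi_sphere n (P : usphere R n) :
  (2 <= n)%N -> @kato_chaotic R (usphere R n) (Phi_sphere P).
Proof.
move=> n2; have P1 : enorm (set_val P) = 1 := set_valP P.
apply: (@arc_kato _ _ _ P1) => //; first exact: usphereN.
have [//|w0 w01 w0P] := @exists_unit_orthogonal R n [:: set_val P].
have {}w0P : dot w0 (set_val P) = 0 by apply: w0P; rewrite mem_head.
move=> x x1; have [w [t [wP xE w1]]] := exists_arc P1 w0P (usphere_udisk x1).
exists w, t; split=> // s; apply: usphere_arc => //; case: w1 => [st|-> //].
have := dot_arc P1 t wP; rewrite -xE -enorm_sqr x1 expr1n => h.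
have /eqP : sin t ^+ 2 * (1 - dot w w) = 0 by lra.
rewrite mulf_eq0 sqrf_eq0 (negbTE st) /= subr_eq0 => /eqP ww.
by rewrite /enorm -ww sqrtr1.
Qed.

(** Here the fallback at the poles is w = 0, available in every dimension. *)
Lemma kato_Phi_disk n (P : usphere R n) :
  @kato_chaotic R (udisk R n) (Phi_disk P).
Proof.
have P1 : enorm (set_val P) = 1 := set_valP P.
apply: (@arc_kato _ _ _ P1) => //.
- exact: usphere_udisk.
- exact/usphere_udisk/usphereN.
move=> x x1; have [w [t [wP xE w1]]] := exists_arc P1 (dot0v _) x1.
exists w, t; split=> // s; apply: udisk_arc => //.
case: w1 => [st|->]; last by rewrite enorm0.
have := dot_arc P1 t wP; rewrite -xE -enorm_sqr => h.
have : enorm x ^+ 2 <= 1 by rewrite expr_le1 // enorm_ge0.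
rewrite h lerBlDr lerDl pmulr_rge0 ?exprn_even_gt0 //.
by rewrite subr_ge0 /enorm => ww; rewrite -[leRHS]sqrtr1 ler_wsqrtr.
Qed.

Lemma devaney_Phi_sphere (P : usphere R 2) :
  @devaney_chaotic R (usphere R 2) (Phi_sphere P).
Proof.
have P1 : enorm (set_val P) = 1 := set_valP P.
have dot2 (x y : euclid R 2) : dot x y = x 0 0 * y 0 0 + x 0 1 * y 0 1.
  by rewrite /dot !big_ord_recl big_ord0 addr0; congr (_ * _ + x 0 _ * y 0 _);
    apply: val_inj.
set p := set_val P in P1 *.
(* This is [p] after a quarter turn, so [p] and [w] form an orthonormal basis. *)
pose w : euclid R 2 := \row_i (if i == 0 then - p 0 1 else p 0 0).
have w0 : w 0 0 = - p 0 1 by rewrite mxE.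
have w1 : w 0 1 = p 0 0 by rewrite mxE.
have pp : p 0 0 ^+ 2 + p 0 1 ^+ 2 = 1.
  by have := enorm_sqr p; rewrite P1 dot2; lra.
have wP : dot w p = 0 by rewrite dot2 w0 w1; ring.
have ww : enorm w = 1.
  by rewrite -[RHS]sqrtr1 /enorm dot2 w0 w1 -pp; congr Num.sqrt; ring.
have [] : @topologically_transitive R (usphere R 2) (Phi_sphere P) /\
    dense (@periodic_points R (usphere R 2) (Phi_sphere P)).
  apply: (@arc_devaney R 2 p P1 _ (Phi_sphere P) (fun=> erefl) w) => // [t|x x1].
    exact: usphere_arc.
  have xx : x 0 0 ^+ 2 + x 0 1 ^+ 2 = 1.
    by have := enorm_sqr x; rewrite x1 dot2; lra.
  have [|t [ct st]] := @cos_sin_surj _ (dot x p) (dot x w).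
    transitivity ((x 0 0 ^+ 2 + x 0 1 ^+ 2) * (p 0 0 ^+ 2 + p 0 1 ^+ 2)).
      by rewrite !dot2 w0 w1; ring.
    by rewrite xx pp mulr1.
  (* With this factor, the expansion of [x] in the basis becomes linear in the monomials, as [lra]
     requires. *)
  have xE i : x 0 i = x 0 i * (p 0 0 ^+ 2 + p 0 1 ^+ 2) by rewrite pp mulr1.
  exists t; apply/rowP => i; rewrite /arc ct st !dot2 w0 w1 2!mxE [in RHS]mxE.
  case: i xE => -[|[|//]] hi xE.
    have -> : Ordinal hi = 0 by apply: val_inj.
    by rewrite w0; have := xE 0; lra.
  have -> : Ordinal hi = 1 by apply: val_inj.
  by rewrite w1; have := xE 1; lra.
by move=> tr per; split=> //; have [] := kato_Phi_sphere P (leqnn 2).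
Qed.

Lemma euclid1_collinear (p x : euclid R 1) :
  enorm p = 1 -> x = dot x p *: p.
Proof.
have dot1 (y z : euclid R 1) : dot y z = y 0 0 * z 0 0.
  by rewrite /dot big_ord1.
move=> p1; have pp : p 0 0 ^+ 2 = 1.
  by have := enorm_sqr p; rewrite p1 dot1; lra.
by apply/rowP => i; rewrite ord1 mxE dot1 -mulrA -expr2 pp mulr1.
Qed.

(** The degenerate arc [cos t P] runs over the whole segment; in the coordinate a = x . P the map is
    the Chebyshev polynomial 2 a^2 - 1. *)
Lemma devaney_Phi_disk (P : usphere R 1) :
  @devaney_chaotic R (udisk R 1) (Phi_disk P).
Proof.
have P1 : enorm (set_val P) = 1 := set_valP P.
have [] : @topologically_transitive R (udisk R 1) (Phi_disk P) /\
    dense (@periodic_points R (udisk R 1) (Phi_disk P)).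
  apply: (@arc_devaney R 1 _ P1 _ (Phi_disk P) (fun=> erefl) 0) => [|t|x x1].
  - exact: dot0v.
  - by apply: udisk_arc; rewrite ?dot0v ?enorm0.
  have a1 : -1 <= dot x (set_val P) <= 1.
    by rewrite -ler_norml (le_trans (dot_le _ _)) // P1 mulr1.
  exists (acos (dot x (set_val P))).
  by rewrite /arc acosK ?in_itv // scaler0 addr0 -euclid1_collinear.
by move=> tr per; split=> //; have [] := kato_Phi_disk P.
Qed.

(** Take [e] and [v] so that [P], [e], [v] are orthonormal, which uses 3 <= n: the invariant is 1/2
    at [e] and -1/2 at [v]. *)
Lemma not_transitive_Phi_sphere n (P : usphere R n) :
  (3 <= n)%N -> ~ @topologically_transitive R (usphere R n) (Phi_sphere P).
Proof.
move=> n3; have P1 : enorm (set_val P) = 1 := set_valP P.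
have [|e e1 eP] := @exists_unit_orthogonal R n [:: set_val P].
  exact: ltn_trans n3.
have [//|v v1 vP] := @exists_unit_orthogonal R n [:: set_val P; e].
have {}eP : dot e (set_val P) = 0 by apply: eP; rewrite !inE eqxx.
have ve : dot v e = 0 by apply: vP; rewrite !inE eqxx orbT.
have {}vP : dot v (set_val P) = 0 by apply: vP; rewrite !inE eqxx.
apply: (@Phi_restriction_not_transitive _ _ _ P1 _ _ _ e
  (SigSub (mem_set e1)) (SigSub (mem_set v1))) => //=.
  by rewrite eP -enorm_sqr e1; lra.
by rewrite vP ve; lra.
Qed.

(** The centre, where the invariant is -1/2, replaces [v], so a single direction orthogonal to [P]
    suffices. *)
Lemma not_transitive_Phi_disk n (P : usphere R n) :
  (2 <= n)%N -> ~ @topologically_transitive R (udisk R n) (Phi_disk P).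
Proof.
move=> n2; have P1 : enorm (set_val P) = 1 := set_valP P.
have [//|e e1 eP] := @exists_unit_orthogonal R n [:: set_val P].
have {}eP : dot e (set_val P) = 0 by apply: eP; rewrite !inE eqxx.
have d0 : udisk R n 0 by rewrite /udisk /= enorm0.
apply: (@Phi_restriction_not_transitive _ _ _ P1 _ _ _ e
  (SigSub (mem_set (usphere_udisk e1))) (SigSub (mem_set d0))) => //=.
  by rewrite eP -enorm_sqr e1; lra.
by rewrite !dot0v; lra.
Qed.

End SphereDisk.

Theorem theorem1 (R : realType) :
  [/\ (* (1) *)
      (forall P : usphere R 2,
         devaney_chaotic (Phi_sphere P) /\ kato_chaotic (Phi_sphere P)),
      (* (2) *)
      (forall P : usphere R 1,
         devaney_chaotic (Phi_disk P) /\ kato_chaotic (Phi_disk P)),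
      (* (3) *)
      (forall m : nat, 2 <= m ->
         (forall P : usphere R m.+1, kato_chaotic (Phi_sphere P)) /\
         (forall P : usphere R m, kato_chaotic (Phi_disk P)))
    & (* (4) *)
      (forall m : nat, 2 <= m ->
         (forall P : usphere R m.+1,
            ~ topologically_transitive (Phi_sphere P) /\
            ~ devaney_chaotic (Phi_sphere P)) /\
         (forall P : usphere R m,
            ~ topologically_transitive (Phi_disk P) /\
            ~ devaney_chaotic (Phi_disk P)))].
Proof.
split=> [P|P|m m2|m m2].
- by split; [exact: devaney_Phi_sphere|exact: kato_Phi_sphere].
- by split; [exact: devaney_Phi_disk|exact: kato_Phi_disk].
- by split=> P; [exact/kato_Phi_sphere/leqW|exact: kato_Phi_disk].
- split=> P.
    have ntr := @not_transitive_Phi_sphere R m.+1 P m2.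
    by split=> // -[_ /ntr].
  have ntr := @not_transitive_Phi_disk R m P m2.
  by split=> // -[_ /ntr].
Qed.
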